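(* Let $d\ge2$ and let $\Delta_d=\{a\in\mathbb{R}^d:a_i\ge0,\ \sum_{i=1}^d a_i=1\}$. Assume $f:\Delta_d\to\mathbb{R}$ is convex on $\Delta_d$ and $L$-smooth with respect to $\|\cdot\|_1$ on the relative interior of $\Delta_d$, for $L>0$. Consider exponentiated gradient descent $$\tilde\theta_{t+1}=\theta_t\odot\exp(-\eta\nabla f(\theta_t)),\qquad\theta_{t+1}=\tilde\theta_{t+1}/\|\tilde\theta_{t+1}\|_1,\qquad t=0,1,2,\dots,$$ with constant step size $\eta\in(0,1/L]$ and initial point $\theta_0=\pi$, where $\pi=(1/d,\dots,1/d)\in\Delta_d$ is the uniform distribution. Then for any $T\ge1$ and $\lambda_T=1/(\eta T)$, $$\min_{z\in\Delta_d}\Big(f(z)+\frac{\lambda_T}{4}\|\pi-z\|_1^2\Big)\le f(\theta_T)+\frac{\lambda_T}{4}\|\pi-\theta_T\|_1^2$$ $$\le\min_{z\in\Delta_d}\Big(f(z)+\lambda_T\cdot\min\Big\{\frac{d+1}{2}\|\pi-z\|_1^2,\ \frac12\|\pi-z\|_1^2+\frac{\log d}{2(1-1/d)}\|\pi-z\|_1\Big\}\Big).$$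
   Context: $\odot$ denotes coordinatewise multiplication and $\exp$ acts coordinatewise. $f$ is $L$-smooth with respect to $\|\cdot\|_1$ on a set if its gradient $\nabla f\in\mathbb{R}^d$ is defined there (e.g. $f$ extends differentiably to a neighborhood) and $\|\nabla f(x)-\nabla f(y)\|_\infty\le L\|x-y\|_1$ for all $x,y$ in the set. Exponentiated gradient descent is mirror descent on $\Omega=\mathcal{C}=\Delta_d$ with potential the negative entropy $\phi(u)=\sum_{i=1}^d u_i\log u_i$, which is 1-strongly convex with respect to $\|\cdot\|_1$, and whose Bregman divergence is the Kullback-Leibler divergence.
   Formalization: The minima over the simplex are stated as infima, since a convex f may jump up at the relative boundary and the minimum then need not be attained; whenever a minimum exists it equals the infimum. *)

(* Defs.v *)
From HB Require Import structures.
From mathcomp Require Import all_boot all_order all_algebra.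
From mathcomp Require Import all_classical all_reals all_analysis.

Set Implicit Arguments.
Unset Strict Implicit.
Unset Printing Implicit Defensive.

Import Order.TTheory GRing.Theory Num.Theory.
Import numFieldNormedType.Exports.

Local Open Scope classical_set_scope.
Local Open Scope ring_scope.

Definition simplex (R : realType) (d : nat) : set 'rV[R]_d :=
  [set a | (forall i, 0 <= a ord0 i) /\ \sum_i a ord0 i = 1].

Definition affine_hull (R : realType) (V : lmodType R) (A : set V) : set V :=
  [set x | exists n (c : 'I_n -> R) (p : 'I_n -> V),
    [/\ forall i, A (p i), \sum_i c i = 1 & x = \sum_i c i *: p i]].

Definition relative_interior (R : realType) (V : normedModType R) (A : set V) :
    set V :=
  [set x | A x /\ \forall y \near x, affine_hull A y -> A y].

Definition l1norm (R : realType) (d : nat) (x : 'rV[R]_d) : R :=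
  \sum_i `|x ord0 i|.

Definition gradient (R : realType) (d : nat) (f : 'rV[R]_d -> R)
    (x : 'rV[R]_d) : 'rV[R]_d :=
  \row_i 'D_(delta_mx ord0 i) f x.

(* The norm [`| _ |] on ['rV[R]_d] is the sup norm, i.e., the dual norm of
   [l1norm]. A function defined on a subset of [R^d] only is represented by an
   ambient function [f] that extends it; [f] has to be differentiable only at
   the points of [A]. *)
Definition l1_smooth_on (R : realType) (d : nat) (L : R) (A : set 'rV[R]_d)
    (f : 'rV[R]_d -> R) : Prop :=
  (forall x, A x -> differentiable f x) /\
  (forall x y, A x -> A y ->
    `|gradient f x - gradient f y| <= L * l1norm (x - y)).

Definition uniform_distr (R : realType) (d : nat) : 'rV[R]_d :=
  const_mx (d%:R^-1).

Definition egd_step (R : realType) (d : nat) (f : 'rV[R]_d -> R) (eta : R)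
    (theta : 'rV[R]_d) : 'rV[R]_d :=
  let theta' := map2_mx *%R theta (map_mx expR (- eta *: gradient f theta)) in
  (l1norm theta')^-1 *: theta'.

Definition egd (R : realType) (d : nat) (f : 'rV[R]_d -> R) (eta : R)
    (t : nat) : 'rV[R]_d :=
  iter t (egd_step f eta) (uniform_distr R d).

(* The infimum is taken in the extended reals, where it always exists and is
   the minimum whenever the latter is attained. It need not be attained: a
   convex function on the simplex may jump up at the relative boundary. *)
Definition simplex_inf (R : realType) (d : nat) (F : 'rV[R]_d -> R) : \bar R :=
  ereal_inf [set (F z)%:E | z in @simplex R d].

(* Main.v *)
Require Import Defs.
From HB Require Import structures.
From mathcomp Require Import all_boot all_order all_algebra.
From mathcomp Require Import all_classical all_reals all_analysis.
From mathcomp Require Import ring lra.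
Import Order.TTheory GRing.Theory Num.Theory.
Import numFieldNormedType.Exports.
Local Open Scope classical_set_scope.
Local Open Scope ring_scope.

Set Implicit Arguments.
Unset Strict Implicit.
Unset Printing Implicit Defensive.

(** The iterates stay in the open simplex, so the last one is a competitor in
    the first infimum, which is the lower bound.

    For the upper bound, exponentiated gradient descent is mirror descent whose
    Bregman divergence is the Kullback-Leibler divergence [kl].  The three-point
    identity of a step ([three_point]), the descent lemma, the tangent
    inequality of convexity and Pinsker's inequality give
    [eta * (f x' - f z) <= kl z x - kl z x'] for one step from [x] to [x'] and
    any [z] in the simplex ([egd_step_le]).  Values decrease along the iterates,
    so with [u] the uniform distribution and [x] the [T]-th iterate, summing
    over [T] steps yields [eta * T * (f x - f z) <= kl z u - kl z x]
    ([egd_regret]).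

    The implicit regularization comes from keeping the negative term: Pinsker
    bounds [kl z x] below by [1 / 2 * l1norm (z - x) ^+ 2], and with the
    triangle inequality this absorbs the penalty [1 / 4 * l1norm (u - x) ^+ 2]
    at the cost of [1 / 2 * l1norm (u - z) ^+ 2] ([egd_value_le]).  The two
    branches of the minimum are then two upper bounds on [kl z u]: by the chi-squared divergence
    ([kl_uniform_le_sq]), and by the chord of [x ln x] through the vertices of
    the simplex ([kl_uniform_le_chord]).

    Smoothness is applied at the iterates and on the segments between them; the
    competitor [z] enters through convexity alone, so it may be a boundary point
    at which [f] jumps. *)

(** * Logarithm inequalities *)

Lemma ln_le_sub1 (R : realType) (x : R) : 0 < x -> ln x <= x - 1.
Proof.
by move=> x0; rewrite -[x in ln x](subrKC 1) le_ln1Dx //; lra.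
Qed.

(** The left-hand side, which is [(x - 1) (5 x + 1) / (2 x (x + 2))] in partial
    fractions, has third-order contact with [ln] at [1]: the difference has
    derivative [(x - 1)^3 / (x^2 (x + 2)^2)], so it decreases before [1],
    increases after, and vanishes at [1]. *)
Lemma ln_ge_rational (R : realType) (x : R) : 0 < x ->
  5 / 2 - 1 / 4 * x^-1 - 27 / 4 * (x + 2)^-1 <= ln x.
Proof.
move=> x0.
pose k (y : R) : R := ln y + 1 / 4 * y^-1 + 27 / 4 * (y + 2)^-1.
pose k' (y : R) : R := (y - 1) ^+ 3 / (y ^+ 2 * (y + 2) ^+ 2).
have dk (y : R) : 0 < y -> is_derive y 1 k (k' y).
  move=> y0.
  have y0' : y != 0 by rewrite gt_eqF.
  have y2' : y + 2 != 0 by apply: lt0r_neq0; lra.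
  have dln : is_derive y 1 (@ln R) y^-1 by exact: is_derive1_ln.
  have dV : is_derive y 1 (fun z : R => z^-1) (- y ^- 2 *: 1).
    exact: (@is_deriveV _ id _ _ 1).
  have dV2 : is_derive y 1 (fun z : R => (z + 2)^-1)
      (- (y + 2) ^- 2 *: (1 + 0)).
    exact: (@is_deriveV _ (fun z : R => z + 2)).
  have -> : k = @ln R + ((1 / 4 : R) \*: (fun z : R => z^-1) : R -> R)
                 + ((27 / 4 : R) \*: (fun z : R => (z + 2)^-1) : R -> R).
    by [].
  apply: is_derive_eq; rewrite /k' /GRing.scale /=.
  by field; rewrite y0' y2'.
have ck (a b : R) : 0 < a -> {within `[a, b], continuous k}.
  move=> a0; apply: derivable_within_continuous => y.
  by rewrite in_itv /= => /andP[ay _]; have [] := dk y (lt_le_trans a0 ay).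
have k1 : k 1 = 5 / 2 by rewrite /k ln1; field.
suff : k 1 <= k x by rewrite k1 /k; lra.
have den (c : R) : 0 <= c ^+ 2 * (c + 2) ^+ 2 by rewrite mulr_ge0 ?sqr_ge0.
have [x1|x1] := leP 1 x.
- have [c ||c] := @MVT_segment R k k' 1 x x1.
  + by rewrite in_itv /= => /andP[c1 _]; apply: dk; lra.
  + exact: ck.
  rewrite in_itv /= => /andP[c1 _] e.
  rewrite -subr_ge0 e mulr_ge0 ?subr_ge0 // /k' divr_ge0 //.
  by rewrite exprn_ge0 // subr_ge0.
- have [c ||c] := @MVT_segment R k k' x 1 (ltW x1).
  + by rewrite in_itv /= => /andP[c1 _]; apply: dk; lra.
  + exact: ck.
  rewrite in_itv /= => /andP[_ c1] e.
  rewrite -subr_le0 e mulr_le0_ge0 ?subr_ge0 ?(ltW x1) // /k'.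
  rewrite mulr_le0_ge0 ?invr_ge0 //.
  by rewrite exprS mulr_le0_ge0 ?sqr_ge0 // subr_le0.
Qed.

(** The classical pointwise form of Pinsker's inequality; for positive [z] it
    is [ln_ge_rational] at [z / w] with denominators cleared.  Summed over
    coordinates, the first factor on the right has total mass [6], which is
    what makes the constant in [pinsker] sharp. *)
Lemma pinsker_scalar (R : realType) (z w : R) : 0 <= z -> 0 < w ->
  3 * (z - w) ^+ 2 <= (4 * w + 2 * z) * (z * (ln z - ln w) - z + w).
Proof.
rewrite le_eqVlt => /predU1P[<-|z0] w0; first by nra.
have x0 : 0 < z / w by rewrite divr_gt0.
have := ln_ge_rational x0.
rewrite ln_div ?posrE // => h.
have e : (4 * w + 2 * z) *
    (z * (5 / 2 - 1 / 4 * (z / w)^-1 - 27 / 4 * (z / w + 2)^-1) - z + w) =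
    3 * (z - w) ^+ 2.
  by field; rewrite !lt0r_neq0 //; lra.
rewrite -e ler_wpM2l //; first by lra.
by rewrite lerD2r lerD2r ler_wpM2l // ltW.
Qed.

(** By convexity, [x * ln (n x)] lies below its chord on [[n^-1, 1]] and is
    nonpositive before [n^-1]; the factor [`|n^-1 - x| + (x - n^-1)] is twice
    the positive part of [x - n^-1] and covers both cases at once. *)
Lemma xlnx_le_chord (R : realType) (n x : R) : 1 < n -> 0 <= x -> x <= 1 ->
  x * (ln x - ln n^-1) <=
  ln n / (2 * (1 - n^-1)) * (`|n^-1 - x| + (x - n^-1)).
Proof.
move=> n1 x0 x1.
have n0 : 0 < n by lra.
have ni1 : n^-1 < 1 by rewrite invf_lt1.
have ni0 : 0 < n^-1 by rewrite invr_gt0.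
rewrite lnV ?posrE // opprK.
have [xn|nx] := ltP x n^-1.
  rewrite ger0_norm; last lra.
  rewrite addrA subrK subrr mulr0.
  move: x0; rewrite le_eqVlt => /predU1P[<-|x0]; first by rewrite mul0r.
  apply: mulr_ge0_le0; first exact: ltW.
  rewrite -lnM ?posrE // ln_le0 //.
  by rewrite -(mulVf (lt0r_neq0 n0)) ler_wpM2r // ltW.
have {}x0 : 0 < x by lra.
rewrite ler0_norm; last lra.
(* [x] is the convex combination [a * 1 + (1 - a) * n^-1]; the chord bound is
   the corresponding combination of the tangent inequalities at [x] for
   [y * ln y], evaluated at [y = 1] and at [y = n^-1]. *)
pose a := (x - n^-1) / (1 - n^-1); pose b := (1 - a) / n.
have a0 : 0 <= a by rewrite divr_ge0; lra.
have b0 : 0 <= b.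
  by rewrite divr_ge0 ?(ltW n0) // subr_ge0 ler_pdivrMr; lra.
have bn : b * n = 1 - a by rewrite divfK ?gt_eqF.
have xE : x = a + b by rewrite /b /a; field; rewrite !gt_eqF //; lra.
have -> : ln n / (2 * (1 - n^-1)) * (- (n^-1 - x) + (x - n^-1)) = a * ln n.
  by rewrite /a; field; rewrite !gt_eqF //; lra.
have at1 := ln_le_sub1 x0.
have := ln_le_sub1 (mulr_gt0 x0 n0); rewrite lnM ?posrE // => atn.
rewrite -subr_ge0 in at1; rewrite -subr_ge0 in atn.
have := addr_ge0 (mulr_ge0 a0 at1) (mulr_ge0 b0 atn).
set l := ln x; set m := ln n.
have -> : a * (x - 1 - l) + b * (x * n - 1 - (l + m)) =
    (a + b * n) * x - (a + b) * (1 + l) - b * m by ring.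
rewrite bn -xE => h.
have -> : x * (l + m) = x * l + (a + b) * m by rewrite -xE mulrDr.
lra.
Qed.

(** * Kullback-Leibler divergence on the simplex *)

(** The Kullback-Leibler divergence of [z] from [w].  As [ln] vanishes at [0],
    the convention [0 ln 0 = 0] holds, so [z] may lie on the boundary of the
    simplex. *)
Definition kl (R : realType) (d : nat) (z w : 'rV[R]_d) : R :=
  \sum_i z ord0 i * (ln (z ord0 i) - ln (w ord0 i)).

Lemma l1normC (R : realType) (d : nat) (x y : 'rV[R]_d) :
  l1norm (x - y) = l1norm (y - x).
Proof. by apply: eq_bigr => i _; rewrite !mxE distrC. Qed.

Lemma l1norm_ge0 (R : realType) (d : nat) (x : 'rV[R]_d) : 0 <= l1norm x.
Proof. exact: sumr_ge0. Qed.

Lemma l1norm_triangle (R : realType) (d : nat) (y x z : 'rV[R]_d) :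
  l1norm (x - z) <= l1norm (x - y) + l1norm (y - z).
Proof.
rewrite -big_split ler_sum //= => i _.
by rewrite !mxE; apply: ler_distD.
Qed.

Lemma pinsker (R : realType) (d : nat) (z w : 'rV[R]_d) :
  simplex z -> simplex w -> (forall i, 0 < w ord0 i) ->
  1 / 2 * l1norm (z - w) ^+ 2 <= kl z w.
Proof.
move=> [z0 z1] [_ w1] w0.
pose a := l1norm (z - w).
(* The Cauchy-Schwarz step in linearized form: [s^2 <= p * q] gives
   [a * s - a^2 / 4 * p <= q] for every [a], and the choice of [a] as the
   total of the [s] is optimal, the [p] having total [2]. *)
have : \sum_i (a * `|(z - w) ord0 i| -
         a ^+ 2 / 4 * ((4 * w ord0 i + 2 * z ord0 i) / 3)) <=
       \sum_i (z ord0 i * (ln (z ord0 i) - ln (w ord0 i))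
               - z ord0 i + w ord0 i).
  apply: ler_sum => i _; rewrite !mxE.
  have zi := z0 i; have wi := w0 i.
  have := pinsker_scalar zi wi.
  rewrite -(real_normK (num_real (z ord0 i - w ord0 i))).
  set p := `|_|; set D := _ * (_ - _) - _ + _ => h.
  have p0 : 0 < 4 * w ord0 i + 2 * z ord0 i by lra.
  rewrite -(ler_pM2l p0); apply: le_trans h.
  have := sqr_ge0 (p - a * ((4 * w ord0 i + 2 * z ord0 i) / 6)).
  set q := 4 * w ord0 i + 2 * z ord0 i; nra.
rewrite !big_split /= !sumrN -!mulr_sumr -mulr_suml big_split /= -!mulr_sumr.
rewrite z1 w1 -/(l1norm (z - w)) -/a -/(kl z w); lra.
Qed.

Lemma kl_ge0 (R : realType) (d : nat) (z w : 'rV[R]_d) :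
  simplex z -> simplex w -> (forall i, 0 < w ord0 i) -> 0 <= kl z w.
Proof.
move=> zS wS w0; apply: le_trans (pinsker zS wS w0).
by rewrite mulr_ge0 ?sqr_ge0.
Qed.

(** The positive and negative parts of a zero-sum vector have the same mass. *)
Lemma abs_le_half_l1norm (R : realType) (d : nat) (v : 'rV[R]_d) (i : 'I_d) :
  \sum_j v ord0 j = 0 -> `|v ord0 i| <= l1norm v / 2.
Proof.
move=> v0; rewrite ler_pdivlMr // /l1norm (bigD1 i) //=.
rewrite mulr2n mulrDr mulr1 lerD2l.
move: v0; rewrite (bigD1 i) //= => /eqP; rewrite addr_eq0 => /eqP ->.
by rewrite normrN; apply: ler_norm_sum.
Qed.

Lemma sum_uniform_distr (R : realType) (d : nat) : (0 < d)%N ->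
  \sum_(i < d) uniform_distr R d ord0 i = 1.
Proof.
move=> d0; under eq_bigr do rewrite mxE.
by rewrite sumr_const card_ord -[_ *+ d]mulr_natr mulVf // pnatr_eq0 -lt0n.
Qed.

(** The divergence is at most the chi-squared divergence, here [d] times the
    squared Euclidean distance; and for a zero-sum vector [v] the squared
    Euclidean norm is at most [max |v_i| * l1norm v <= l1norm v ^+ 2 / 2]. *)
Lemma kl_uniform_le_sq (R : realType) (d : nat) (z : 'rV[R]_d) :
  (0 < d)%N -> simplex z ->
  kl z (uniform_distr R d) <= d%:R / 2 * l1norm (uniform_distr R d - z) ^+ 2.
Proof.
move=> d0 [z0 z1]; set u := uniform_distr R d.
have dR : (0 : R) < d%:R by rewrite ltr0n.
rewrite l1normC.
pose v := z - u.
have vE i : v ord0 i = z ord0 i - u ord0 i by rewrite !mxE.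
have v0 : \sum_j v ord0 j = 0.
  by under eq_bigr do rewrite vE; rewrite sumrB z1 sum_uniform_distr // subrr.
have -> : l1norm (z - u) ^+ 2 = 2 * \sum_i l1norm v / 2 * `|v ord0 i|.
  by rewrite -mulr_sumr -/(l1norm v) -/v; field.
rewrite mulrA divfK ?pnatr_eq0 // mulr_sumr.
(* Adding the zero-sum terms [v_i] makes the comparison hold coordinatewise. *)
have e : \sum_i (z ord0 i - u ord0 i + d%:R * v ord0 i ^+ 2) =
         \sum_i d%:R * v ord0 i ^+ 2.
  rewrite big_split /= -[RHS]add0r; congr +%R.
  by rewrite -[RHS]v0; apply: eq_bigr => i _; rewrite vE.
apply: (@le_trans _ _ (\sum_i d%:R * v ord0 i ^+ 2)); last first.
  apply: ler_sum => i _; rewrite ler_pM2l //.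
  rewrite -(real_normK (num_real (v ord0 i))) expr2 ler_wpM2r //.
  exact: abs_le_half_l1norm.
rewrite -e; apply: ler_sum => i _.
have := z0 i; rewrite !mxE le_eqVlt => /predU1P[<-|zi].
  rewrite mul0r le_eqVlt; apply/orP; left; apply/eqP; field; exact: lt0r_neq0.
have ui : (0 : R) < d%:R^-1 by rewrite invr_gt0.
rewrite -ln_div ?posrE // invrK.
have := @ln_le_sub1 R (z ord0 i * d%:R) (mulr_gt0 zi dR).
move=> /(ler_wpM2l (ltW zi)) /le_trans; apply.
rewrite le_eqVlt; apply/orP; left; apply/eqP; field; exact: lt0r_neq0.
Qed.

(** Equality holds at the vertices of the simplex, where the divergence is
    [ln d] and the distance to the uniform distribution is [2 (1 - 1/d)]. *)
Lemma kl_uniform_le_chord (R : realType) (d : nat) (z : 'rV[R]_d) :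
  (1 < d)%N -> simplex z ->
  kl z (uniform_distr R d) <=
  ln d%:R / (2 * (1 - d%:R^-1)) * l1norm (uniform_distr R d - z).
Proof.
move=> d1 [z0 z1].
have dR : (1 : R) < d%:R by rewrite ltr1n.
set c := _ / _.
(* Adding the zero-sum terms turns the absolute values into positive parts. *)
have -> : l1norm (uniform_distr R d - z) =
    \sum_i (`|d%:R^-1 - z ord0 i| + (z ord0 i - d%:R^-1)).
  rewrite big_split /= sumrB z1 sumr_const card_ord -[_^-1 *+ d]mulr_natr.
  rewrite mulVf ?subrr ?addr0 ?gt_eqF //; last lra.
  by apply: eq_bigr => i _; rewrite !mxE.
rewrite mulr_sumr; apply: ler_sum => i _; rewrite mxE.
apply: xlnx_le_chord => //.
by rewrite -z1 (bigD1 i) //= lerDl sumr_ge0.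
Qed.

(** * First-order inequalities for convex and for smooth functions *)

(** This is the relative interior of the simplex, in the coordinatewise form
    that the iterates visibly satisfy. *)
Definition open_simplex (R : realType) (d : nat) : set 'rV[R]_d :=
  [set a | simplex a /\ forall i, 0 < a ord0 i].

Definition dotp (R : realType) (d : nat) (g v : 'rV[R]_d) : R :=
  \sum_i g ord0 i * v ord0 i.

Lemma open_simplex_relint (R : realType) (d : nat) (x : 'rV[R]_d) :
  open_simplex x -> relative_interior (@simplex R d) x.
Proof.
move=> [xS x0]; split => //.
have x0' i : \forall y \near x, 0 < (y : 'rV[R]_d) ord0 i.
  have /(cvgr_gt (x ord0 i)) := @coord_continuous R 1 d ord0 i x.
  by apply.
have {}x0' := filter_forall _ x0'.
near=> y => -[n [c [p [pS c1 yE]]]]; split.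
  by move=> i; apply/ltW; move: i; near: y; exact: x0'.
rewrite yE.
under eq_bigr do rewrite summxE.
rewrite exchange_big /= -c1; apply: eq_bigr => j _.
under eq_bigr do rewrite mxE.
by have [_ p1] := pS j; rewrite -mulr_sumr p1 mulr1.
Unshelve. all: by end_near. Qed.

Lemma dotp_le_norm (R : realType) (d : nat) (g v : 'rV[R]_d) :
  dotp g v <= `|g| * l1norm v.
Proof.
rewrite /l1norm mulr_sumr; apply: ler_sum => i _.
rewrite (le_trans (ler_norm _)) // normrM ler_wpM2r //.
rewrite /Num.norm /= mx_normrE.
exact: (le_bigmax _ (fun ij : 'I_1 * 'I_d => `|g ij.1 ij.2|) (ord0, i)).
Qed.

Lemma dotpBl (R : realType) (d : nat) (g h v : 'rV[R]_d) :
  dotp (g - h) v = dotp g v - dotp h v.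
Proof. by rewrite -sumrB; apply: eq_bigr => i _; rewrite !mxE mulrBl. Qed.

Lemma derive_dotp (R : realType) (d : nat) (f : 'rV[R]_d -> R)
    (x v : 'rV[R]_d) :
  differentiable f x -> 'D_v f x = dotp (gradient f x) v.
Proof.
move=> df; rewrite deriveE // [in LHS](row_sum_delta v) linear_sum.
apply: eq_bigr => i _.
by rewrite linearZ mxE deriveE // mulrC.
Qed.

Lemma is_derive_line (R : realType) (d : nat) (f : 'rV[R]_d -> R)
    (x v : 'rV[R]_d) (t : R) : differentiable f (x + t *: v) ->
  is_derive t 1 (fun s => f (x + s *: v)) (dotp (gradient f (x + t *: v)) v).
Proof.
move=> df; have D : derivable f (x + t *: v) v by exact: diff_derivable.
rewrite -derive_dotp //.
have e : (fun h : R => h^-1 *: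
      (((fun s => f (x + s *: v)) \o shift t) (h *: (1 : R)) - f (x + t *: v))) =
    (fun h : R => h^-1 *:
      ((f \o shift (x + t *: v)) (h *: v) - f (x + t *: v))).
  apply/funext => h; congr (_ *: (f _ - _)).
  have -> : h *: (1 : R) = h by exact: mulr1.
  by rewrite /= scalerDl addrCA.
by split; rewrite /derivable /derive /= e.
Qed.

(** The right difference quotients of [f] at [x] towards [z] are at most
    [f z - f x].  The point [z] may be on the boundary of the simplex, where
    [f] need not be continuous: only the convexity inequality is used there. *)
Lemma convex_tangent_le (R : realType) (d : nat) (f : 'rV[R]_d -> R)
    (x z : 'rV[R]_d) :
  convex_function (@simplex R d) f -> differentiable f x ->
  simplex x -> simplex z -> f x + dotp (gradient f x) (z - x) <= f z.
Proof.
move=> fc df xS zS; rewrite -lerBrDl -derive_dotp //.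
have /cvg_dnbhs_at_right D := @diff_derivable _ _ _ f x (z - x) df.
apply: (cvgr_to_le D).
near=> t.
have t0 : 0 < t by [].
have t1 : t <= 1 by near: t; exact: nbhs_right_le.
have h : f (t *: (z - x) + x) <= t * f z + (1 - t) * f x.
  have -> : t *: (z - x) + x = t *: z + (1 - t) *: x.
    by rewrite scalerBr scalerBl scale1r addrAC addrA.
  exact: (fc (Itv01 (ltW t0) t1) z x (mem_set zS) (mem_set xS)).
have -> : t^-1 *: (f (t *: (z - x) + x) - f x) =
    t^-1 * (f (t *: (z - x) + x) - f x) by [].
by rewrite ler_pdivrMl //; lra.
Unshelve. all: by end_near. Qed.

Lemma open_simplex_segment (R : realType) (d : nat) (x y : 'rV[R]_d) (t : R) :
  open_simplex x -> open_simplex y -> 0 <= t -> t <= 1 ->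
  open_simplex (x + t *: (y - x)).
Proof.
move=> [[_ x1] x0] [[_ y1] y0] t0 t1.
have p i : 0 < (x + t *: (y - x)) ord0 i.
  rewrite !mxE; have := x0 i; have := y0 i; nra.
split => //; split; first by move=> i; exact: ltW.
under eq_bigr do rewrite !mxE.
by rewrite big_split /= -mulr_sumr sumrB x1 y1 subrr mulr0 addr0.
Qed.

(** Along the segment from [x] to [y], the derivative of [f] exceeds its initial
    value by at most [L t * l1norm (y - x) ^+ 2] at time [t]; hence [f] minus
    the quadratic [q] below is nonincreasing, by the mean value theorem. *)
Lemma descent_lemma (R : realType) (d : nat) (f : 'rV[R]_d -> R) (L : R)
    (x y : 'rV[R]_d) :
  l1_smooth_on L (@open_simplex R d) f -> open_simplex x -> open_simplex y ->
  f y <= f x + dotp (gradient f x) (y - x) + L / 2 * l1norm (y - x) ^+ 2.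
Proof.
move=> [df Lf] xS yS.
pose v := y - x; pose G := dotp (gradient f x) v; pose N := l1norm v.
pose g (t : R) := f (x + t *: v).
pose g' (t : R) := dotp (gradient f (x + t *: v)) v.
pose q (t : R) := G * t + L / 2 * N ^+ 2 * t ^+ 2.
pose q' (t : R) := G + L * N ^+ 2 * t.
have seg (t : R) : 0 <= t -> t <= 1 -> open_simplex (x + t *: v).
  exact: open_simplex_segment.
have dg (t : R) : 0 <= t -> t <= 1 -> is_derive t 1 (g - q) (g' t - q' t).
  move=> t0 t1.
  have dg : is_derive t 1 g (g' t) by apply: is_derive_line; apply/df/seg.
  have -> : q = G \*: (@id R : R -> R) +
      (L / 2 * N ^+ 2) \*: ((@id R) ^+ 2 : R -> R) by [].
  by apply: is_derive_eq; rewrite /q' /GRing.scale /=; field.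
have [t ||t] := @MVT_segment R (g - q) (fun t => g' t - q' t) 0 1 ler01.
- by rewrite in_itv /= => /andP[t0 t1]; apply: dg; exact: ltW.
- apply: derivable_within_continuous => t; rewrite in_itv /= => /andP[t0 t1].
  by have [] := dg t t0 t1.
rewrite in_itv /= subr0 mulr1 => /andP[t0 t1] e.
have : g' t - q' t <= 0.
  have -> : g' t - q' t =
      dotp (gradient f (x + t *: v) - gradient f x) v - L * N ^+ 2 * t.
    by rewrite dotpBl /q' -/G opprD addrA.
  rewrite subr_le0; apply: (le_trans (dotp_le_norm _ _)).
  have -> : L * N ^+ 2 * t = L * l1norm (x + t *: v - x) * N.
    have -> : l1norm (x + t *: v - x) = t * N.
      rewrite addrC addKr /N /l1norm mulr_sumr; apply: eq_bigr => i _.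
      by rewrite mxE normrM ger0_norm.
    by ring.
  by rewrite ler_wpM2r ?l1norm_ge0 //; apply: Lf => //; exact: seg.
have {}e : (g 1 - q 1) - (g 0 - q 0) = g' t - q' t := e.
rewrite -e /g /q scale1r scale0r addr0 /v subrKC -/v -/G -/N; lra.
Qed.

Lemma l1_smooth_onS (R : realType) (d : nat) (L : R) (A B : set 'rV[R]_d) f :
  A `<=` B -> l1_smooth_on L B f -> l1_smooth_on L A f.
Proof.
by move=> AB [df lf]; split=> [x /AB|x y /AB Bx /AB]; [exact: df|exact: lf].
Qed.

(** * Exponentiated gradient descent *)

Lemma open_simplex_uniform (R : realType) (d : nat) : (0 < d)%N ->
  open_simplex (uniform_distr R d).
Proof.
move=> d0.
have u0 i : 0 < uniform_distr R d ord0 i by rewrite mxE invr_gt0 ltr0n.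
split=> //; split; first by move=> i; exact: ltW.
exact: sum_uniform_distr.
Qed.

(** In logarithmic coordinates a step is a gradient step up to a constant
    vector, the logarithm of the normalization factor.  Constants do not matter
    later, since they are paired with zero-sum vectors. *)
Lemma egd_stepP (R : realType) (d : nat) (f : 'rV[R]_d -> R) (eta : R)
    (x : 'rV[R]_d) : open_simplex x ->
  open_simplex (egd_step f eta x) /\
  exists c, forall i,
    ln (egd_step f eta x ord0 i) =
    ln (x ord0 i) - eta * gradient f x ord0 i + c.
Proof.
move=> [[_ x1] x0].
rewrite /egd_step; set y := map2_mx _ _ _.
have yE i : y ord0 i = x ord0 i * expR (- eta * gradient f x ord0 i).
  by rewrite !mxE.
have y0 i : 0 < y ord0 i by rewrite yE mulr_gt0 // expR_gt0.
have ZE : l1norm y = \sum_i y ord0 i.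
  by apply: eq_bigr => i _; rewrite ger0_norm // ltW.
have Z0 : 0 < l1norm y.
  rewrite ZE lt_def sumr_ge0 ?andbT; last by move=> i _; exact: ltW.
  apply/eqP => /psumr_eq0P y_eq0.
  have : \sum_i x ord0 i = 0.
    apply: big1 => i _; have := y0 i.
    by rewrite y_eq0 ?ltxx // => j _; exact: ltW.
  by rewrite x1 => /eqP; rewrite oner_eq0.
have sE i : ((l1norm y)^-1 *: y) ord0 i = (l1norm y)^-1 * y ord0 i.
  by rewrite mxE.
have s0 i : 0 < ((l1norm y)^-1 *: y) ord0 i by rewrite sE mulr_gt0 // invr_gt0.
split.
  split=> //; split; first by move=> i; exact: ltW.
  under eq_bigr do rewrite sE.
  by rewrite -mulr_sumr -ZE mulVf // gt_eqF.
exists (- ln (l1norm y)) => i.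
rewrite sE lnM ?posrE ?invr_gt0 // lnV ?posrE // yE lnM ?posrE ?expR_gt0 //.
by rewrite expRK mulNr addrC.
Qed.

(** The three-point identity of mirror descent for the negative entropy. *)
Lemma three_point (R : realType) (d : nat) (f : 'rV[R]_d -> R) (eta : R)
    (x z : 'rV[R]_d) : open_simplex x -> simplex z ->
  eta * dotp (gradient f x) (z - egd_step f eta x) =
  kl z (egd_step f eta x) - kl z x + kl (egd_step f eta x) x.
Proof.
move=> xS [_ z1]; set x' := egd_step f eta x.
have [[[_ x'1] _] [c lnE]] := egd_stepP f eta xS.
rewrite -/x' in x'1 lnE; clearbody x'.
have -> : kl z x' - kl z x + kl x' x =
   \sum_i (eta * (gradient f x ord0 i * (z - x') ord0 i)
            - c * (z ord0 i - x' ord0 i)).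
  rewrite -sumrB -big_split /=; apply: eq_bigr => i _.
  by rewrite lnE !mxE; ring.
by rewrite big_split /= sumrN -!mulr_sumr sumrB z1 x'1 subrr mulr0 subr0.
Qed.

(** The descent lemma bounds [f x'] and convexity bounds [f z] in terms of the
    tangent at [x]; by the three-point identity, what remains is
    [eta * L / 2 * l1norm (x' - x) ^+ 2 - kl x' x], which is nonpositive by
    Pinsker's inequality since [eta * L <= 1]. *)
Lemma egd_step_le (R : realType) (d : nat) (f : 'rV[R]_d -> R) (L eta : R)
    (x z : 'rV[R]_d) :
  convex_function (@simplex R d) f -> l1_smooth_on L (@open_simplex R d) f ->
  0 < L -> 0 < eta -> eta <= L^-1 -> open_simplex x -> simplex z ->
  eta * (f (egd_step f eta x) - f z) <= kl z x - kl z (egd_step f eta x).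
Proof.
move=> fc fs L0 eta0 etaL xS zS; set x' := egd_step f eta x.
have [x'S _] := egd_stepP f eta xS; rewrite -/x' in x'S.
have smooth := descent_lemma fs xS x'S.
have tangent := convex_tangent_le fc (fs.1 x xS) xS.1 zS.
have threept := three_point f eta xS zS; rewrite -/x' in threept.
have pin := pinsker x'S.1 xS.1 xS.2.
have split_dotp : dotp (gradient f x) (z - x) =
    dotp (gradient f x) (z - x') + dotp (gradient f x) (x' - x).
  rewrite -big_split /=; apply: eq_bigr => i _.
  by rewrite -mulrDr !mxE addrA subrK.
have etaL1 : eta * L <= 1 by rewrite -(mulVf (lt0r_neq0 L0)) ler_wpM2r // ltW.
have gap : eta * (f x' - f z) <=
    eta * (L / 2 * l1norm (x' - x) ^+ 2) - eta * dotp (gradient f x) (z - x').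
  by rewrite -mulrBr ler_pM2l //; lra.
have small : eta * L * l1norm (x' - x) ^+ 2 <= l1norm (x' - x) ^+ 2.
  by rewrite ler_piMl ?sqr_ge0.
rewrite threept in gap; lra.
Qed.

Lemma egd_open_simplex (R : realType) (d : nat) (f : 'rV[R]_d -> R) (eta : R)
    (t : nat) : (0 < d)%N -> open_simplex (egd f eta t).
Proof.
move=> d0; elim: t => [|t IH]; first exact: open_simplex_uniform.
by have [] := egd_stepP f eta IH.
Qed.

(** The one-step bounds telescope; the bound with [z := x] shows that the values
    decrease along the iterates, so that all of them may be replaced by the
    last one. *)
Lemma egd_regret (R : realType) (d : nat) (f : 'rV[R]_d -> R) (L eta : R)
    (z : 'rV[R]_d) (t : nat) : (0 < d)%N ->
  convex_function (@simplex R d) f -> l1_smooth_on L (@open_simplex R d) f ->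
  0 < L -> 0 < eta -> eta <= L^-1 -> simplex z ->
  eta * t%:R * (f (egd f eta t) - f z) <=
  kl z (uniform_distr R d) - kl z (egd f eta t).
Proof.
move=> d0 fc fs L0 eta0 etaL zS.
elim: t => [|t IH]; first by rewrite mulr0 mul0r subrr.
set x := egd f eta t in IH *.
have xS : open_simplex x by exact: egd_open_simplex.
have -> : egd f eta t.+1 = egd_step f eta x by [].
set x' := egd_step f eta x.
have [x'S _] := egd_stepP f eta xS; rewrite -/x' in x'S.
have progress := egd_step_le fc fs L0 eta0 etaL xS zS.
have := egd_step_le fc fs L0 eta0 etaL xS xS.1.
rewrite -/x' in progress *.
have -> : kl x x = 0 by apply: big1 => i _; rewrite subrr mulr0.
rewrite sub0r => descent.
have {}descent : eta * (f x' - f x) <= 0.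
  apply: le_trans descent _.
  by rewrite oppr_le0 kl_ge0 //; [exact: xS.1 | exact: x'S.1 | exact: x'S.2].
have := mulr_ge0_le0 (ler0n R t) descent.
rewrite -natr1; lra.
Qed.

(** The term [- kl z x] of [egd_regret] pays for the penalty at the last iterate
    [x]: by Pinsker it is at most [- 1 / 2 * l1norm (z - x) ^+ 2], while
    [1 / 4 * l1norm (u - x) ^+ 2] is at most
    [1 / 2 * l1norm (u - z) ^+ 2 + 1 / 2 * l1norm (z - x) ^+ 2]. *)
Lemma egd_value_le (R : realType) (d : nat) (f : 'rV[R]_d -> R) (L eta : R)
    (z : 'rV[R]_d) (T : nat) : (0 < d)%N ->
  convex_function (@simplex R d) f -> l1_smooth_on L (@open_simplex R d) f ->
  0 < L -> 0 < eta -> eta <= L^-1 -> (0 < T)%N -> simplex z ->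
  f (egd f eta T) +
    (eta * T%:R)^-1 / 4 * l1norm (uniform_distr R d - egd f eta T) ^+ 2 <=
  f z + (eta * T%:R)^-1 *
    (1 / 2 * l1norm (uniform_distr R d - z) ^+ 2 + kl z (uniform_distr R d)).
Proof.
move=> d0 fc fs L0 eta0 etaL T0 zS.
set lambda := (_)^-1; set u := uniform_distr R d.
set x := egd f eta T.
have xS : open_simplex x by exact: egd_open_simplex.
have l0 : 0 < lambda by rewrite invr_gt0 mulr_gt0 // ltr0n.
have regret : f x - f z <= lambda * (kl z u - kl z x).
  rewrite ler_pdivlMl ?mulr_gt0 ?ltr0n //.
  exact: (egd_regret T d0 fc fs L0 eta0 etaL zS).
have pin := pinsker zS xS.1 xS.2.
have tri := l1norm_triangle z u x.
have : l1norm (u - x) ^+ 2 <= 2 * l1norm (u - z) ^+ 2 + 2 * l1norm (z - x) ^+ 2.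
  apply: le_trans (_ : (l1norm (u - z) + l1norm (z - x)) ^+ 2 <= _).
    by rewrite lerXn2r // nnegrE ?addr_ge0 // l1norm_ge0.
  by have := sqr_ge0 (l1norm (u - z) - l1norm (z - x)); lra.
rewrite -(ler_pM2l l0) => tri2.
rewrite -(ler_pM2l l0) in pin.
lra.
Qed.

Theorem corollary4 (R : realType) (d : nat) (hd : (2 <= d)%N)
    (f : 'rV[R]_d -> R) (L eta : R)
    (hL : 0 < L)
    (fconvex : convex_function (@simplex R d) f)
    (fsmooth : l1_smooth_on L (relative_interior (@simplex R d)) f)
    (heta0 : 0 < eta) (hetaL : eta <= L^-1)
    (T : nat) (hT : (1 <= T)%N) :
  let u := uniform_distr R d in
  let lambda := (eta * T%:R)^-1 in
  let thetaT := egd f eta T in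
  let lower := fun z => f z + lambda / 4 * l1norm (u - z) ^+ 2 in
  let upper := fun z => f z + lambda *
    Num.min ((d%:R + 1) / 2 * l1norm (u - z) ^+ 2)
            (1 / 2 * l1norm (u - z) ^+ 2 +
             ln d%:R / (2 * (1 - d%:R^-1)) * l1norm (u - z)) in
  let value := f thetaT + lambda / 4 * l1norm (u - thetaT) ^+ 2 in
  (simplex_inf lower <= value%:E)%E /\ (value%:E <= simplex_inf upper)%E.
Proof.
move=> u lambda thetaT lower upper value.
have d0 : (0 < d)%N by exact: ltnW.
split.
  apply: ereal_inf_lbound; exists thetaT => //.
  by have [] := egd_open_simplex f eta T d0.
apply: le_ereal_inf_tmp => _ [z zS <-]; rewrite lee_fin.
have smooth := l1_smooth_onS (@open_simplex_relint R d) fsmooth.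
apply: le_trans (egd_value_le d0 fconvex smooth hL heta0 hetaL hT zS) _.
rewrite lerD2l ler_wpM2l ?invr_ge0 ?mulr_ge0 ?ler0n ?(ltW heta0) //.
rewrite le_min lerD2l kl_uniform_le_chord // andbT.
by have := kl_uniform_le_sq d0 zS; lra.
Qed.
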